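(* Consider the binary random graph affiliation mixture model with $Q\ge 2$ groups and $\alpha\ne\beta$. Let $s_k=\sum_{q=1}^Q\pi_q^k$ and $m_1=\mathbb E(X_{12})$, $m_2=\mathbb E(X_{12}X_{13})$, $m_3=\mathbb E(X_{12}X_{13}X_{23})$. (i) If $m_2\ne m_1^2$, then $\boldsymbol\pi$ is non-uniform, the quantities $(m_1^2-m_2)$ and $(2s_2^3-3s_3s_2+s_3)$ are non-zero, and $$\beta=\frac{(s_3-s_2s_3)m_1^3+(s_2^3-s_3)m_2m_1+(s_3s_2-s_2^3)m_3}{(m_1^2-m_2)(2s_2^3-3s_3s_2+s_3)},\qquad \alpha=\frac{m_1+(s_2-1)\beta}{s_2}.$$ (ii) If $m_2=m_1^2$, then $\boldsymbol\pi$ is uniform (i.e. $\pi_q=1/Q$ for all $q$) and $$\beta=m_1+\Big(\frac{m_1^3-m_3}{Q-1}\Big)^{1/3},\qquad \alpha=Qm_1+(1-Q)\beta,$$ where $(\cdot)^{1/3}$ denotes the real cube root.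
   Context: Random graph mixture model: nodes have i.i.d. latent groups $Z_i\in\{1,\dots,Q\}$ with $\pi_q=\mathbb P(Z_i=q)\in(0,1)$, $\sum_q\pi_q=1$; edge variables $X_{ij}$ ($i<j$) are conditionally independent given all $Z$'s, with law of $X_{ij}$ depending only on $(Z_i,Z_j)$. Binary affiliation model: $X_{ij}\in\{0,1\}$ with $\mathbb P(X_{ij}=1\mid Z_i=q,Z_j=l)=\alpha$ if $q=l$ and $=\beta$ if $q\ne l$. In terms of parameters, $m_1=s_2\alpha+(1-s_2)\beta$, $m_2=s_3\alpha^2+2(s_2-s_3)\alpha\beta+(1-2s_2+s_3)\beta^2$, $m_3=s_3\alpha^3+3(s_2-s_3)\alpha\beta^2+(1-3s_2+2s_3)\beta^3$. *)

(* Defs.v *)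
From Stdlib Require Import Reals.
Open Scope R_scope.

Fixpoint rsum (n : nat) (f : nat -> R) : R :=
  match n with O => 0 | S k => rsum k f + f k end.

(* groups are indexed 0..Q-1 *)
Definition s_k (Q : nat) (pi : nat -> R) (k : nat) : R :=
  rsum Q (fun q => pi q ^ k).

Definition aff (alpha beta : R) (q l : nat) : R :=
  if Nat.eqb q l then alpha else beta.

(* m1 = E(X12), m2 = E(X12 X13), m3 = E(X12 X13 X23): expectations obtained
   by conditioning on the i.i.d. latent groups Z1, Z2, Z3 and using the
   conditional independence of the edges. *)
Definition m1 (Q : nat) (pi : nat -> R) (alpha beta : R) : R :=
  rsum Q (fun q => rsum Q (fun l => pi q * pi l * aff alpha beta q l)).

Definition m2 (Q : nat) (pi : nat -> R) (alpha beta : R) : R :=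
  rsum Q (fun q => rsum Q (fun l => rsum Q (fun r =>
    pi q * pi l * pi r * (aff alpha beta q l * aff alpha beta q r)))).

Definition m3 (Q : nat) (pi : nat -> R) (alpha beta : R) : R :=
  rsum Q (fun q => rsum Q (fun l => rsum Q (fun r =>
    pi q * pi l * pi r *
    (aff alpha beta q l * aff alpha beta q r * aff alpha beta l r)))).

Definition uniform (Q : nat) (pi : nat -> R) : Prop :=
  forall q, (q < Q)%nat -> pi q = 1 / INR Q.

Definition cbrt (x : R) : R :=
  if Rlt_dec 0 x then Rpower x (1/3)
  else if Rlt_dec x 0 then - Rpower (- x) (1/3)
  else 0.

(* Main.v *)
(* Conditioning on the latent groups and using
   sum_l pi_l aff(q,l) = beta + delta pi_q  (delta = alpha - beta)
   expresses the moments through the power sums s2, s3: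
     m1 = beta + delta s2,   m2 = beta^2 + 2 beta delta s2 + delta^2 s3,
     m3 = beta^3 + 3 beta^2 delta s2 + 3 beta delta^2 s3 + delta^3 s3.
   Hence m2 - m1^2 = delta^2 (s3 - s2^2), and s3 - s2^2 = sum_q pi_q (pi_q - s2)^2
   vanishes exactly when pi is uniform.  If it does not vanish, the moment equations
   are solved for beta; the denominator 2 s2^3 - 3 s3 s2 + s3 is positive because
   s3^2 <= s2 s4 <= s2^3 (Cauchy-Schwarz).  If pi is uniform, then s2 = 1/Q,
   s3 = 1/Q^2 and (m1^3 - m3)/(Q - 1) = (beta - m1)^3. *)

Require Import Defs.
From Stdlib Require Import Reals Lra Lia Psatz.
Open Scope R_scope.

Lemma rsum_ext n f g : (forall i, (i < n)%nat -> f i = g i) -> rsum n f = rsum n g.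
Proof.
  induction n as [|n IH]; intros Hfg; cbn [rsum]; [reflexivity|].
  rewrite IH by (intros; apply Hfg; lia). rewrite Hfg by lia. reflexivity.
Qed.

Lemma rsum_add n f g : rsum n (fun i => f i + g i) = rsum n f + rsum n g.
Proof. induction n as [|n IH]; cbn [rsum]; [ring|]. rewrite IH; ring. Qed.

Lemma rsum_scale n c f : rsum n (fun i => c * f i) = c * rsum n f.
Proof. induction n as [|n IH]; cbn [rsum]; [ring|]. rewrite IH; ring. Qed.

Lemma rsum_const n c : rsum n (fun _ => c) = INR n * c.
Proof. induction n as [|n IH]; cbn [rsum]; [simpl; ring|]. rewrite IH, S_INR; ring. Qed.

Lemma rsum_le n f g : (forall i, (i < n)%nat -> f i <= g i) -> rsum n f <= rsum n g.
Proof.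
  induction n as [|n IH]; intros Hfg; cbn [rsum]; [lra|].
  pose proof (IH (fun i Hi => Hfg i ltac:(lia))). pose proof (Hfg n ltac:(lia)). lra.
Qed.

Lemma rsum_lt n f g :
  (0 < n)%nat -> (forall i, (i < n)%nat -> f i < g i) -> rsum n f < rsum n g.
Proof.
  intros Hn Hfg. destruct n as [|n]; [lia|]. cbn [rsum].
  pose proof (rsum_le n f g (fun i Hi => Rlt_le _ _ (Hfg i ltac:(lia)))).
  pose proof (Hfg n ltac:(lia)). lra.
Qed.

Lemma rsum_nonneg n f : (forall i, (i < n)%nat -> 0 <= f i) -> 0 <= rsum n f.
Proof.
  intros Hf. replace 0 with (rsum n (fun _ => 0)) by (rewrite rsum_const; ring).
  exact (rsum_le n _ _ Hf).
Qed.

Lemma term_le_rsum n f i :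
  (forall j, (j < n)%nat -> 0 <= f j) -> (i < n)%nat -> f i <= rsum n f.
Proof.
  induction n as [|n IH]; intros Hf Hi; [lia|]. cbn [rsum].
  pose proof (Hf n ltac:(lia)).
  destruct (Nat.eq_dec i n) as [->|Hin].
  - pose proof (rsum_nonneg n f (fun j Hj => Hf j ltac:(lia))). lra.
  - pose proof (IH (fun j Hj => Hf j ltac:(lia)) ltac:(lia)). lra.
Qed.

Lemma rsum_nonneg_eq0 n f i :
  (forall j, (j < n)%nat -> 0 <= f j) -> rsum n f = 0 -> (i < n)%nat -> f i = 0.
Proof. intros Hf Hs Hi. pose proof (term_le_rsum n f i Hf Hi). pose proof (Hf i Hi). lra. Qed.

Lemma rsum_sq_le_sq_rsum n f :
  (forall i, (i < n)%nat -> 0 <= f i) -> rsum n (fun i => f i ^ 2) <= rsum n f ^ 2.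
Proof.
  induction n as [|n IH]; intros Hf; cbn [rsum]; [lra|].
  pose proof (IH (fun i Hi => Hf i ltac:(lia))).
  pose proof (rsum_nonneg n f (fun i Hi => Hf i ltac:(lia))).
  pose proof (Hf n ltac:(lia)). nra.
Qed.

Lemma lagrange_identity n f g :
  rsum n (fun i => rsum n (fun j => (f i * g j - f j * g i) ^ 2)) =
  2 * (rsum n (fun i => f i ^ 2) * rsum n (fun i => g i ^ 2)
       - rsum n (fun i => f i * g i) ^ 2).
Proof.
  set (F := rsum n (fun i => f i ^ 2)); set (G := rsum n (fun i => g i ^ 2));
  set (B := rsum n (fun i => f i * g i)).
  rewrite (rsum_ext n _ (fun i => G * f i ^ 2 + (-2 * B) * (f i * g i) + F * g i ^ 2)).
  - rewrite !rsum_add, !rsum_scale. fold F G B. ring.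
  - intros i _.
    rewrite (rsum_ext n _ (fun j => f i ^ 2 * g j ^ 2 + (-2 * f i * g i) * (f j * g j)
                                    + g i ^ 2 * f j ^ 2)) by (intros; ring).
    rewrite !rsum_add, !rsum_scale. fold F G B. ring.
Qed.

Lemma cauchy_schwarz n f g :
  rsum n (fun i => f i * g i) ^ 2 <= rsum n (fun i => f i ^ 2) * rsum n (fun i => g i ^ 2).
Proof.
  enough (0 <= rsum n (fun i => rsum n (fun j => (f i * g j - f j * g i) ^ 2)))
    by (rewrite lagrange_identity in *; lra).
  apply rsum_nonneg; intros; apply rsum_nonneg; intros; apply pow2_ge_0.
Qed.

Lemma variance_identity n p : rsum n p = 1 ->
  rsum n (fun i => p i * (p i - s_k n p 2) ^ 2) = s_k n p 3 - s_k n p 2 ^ 2.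
Proof.
  intros Hsum. set (s2 := s_k n p 2).
  rewrite (rsum_ext n _ (fun i => p i ^ 3 + (-2 * s2) * p i ^ 2 + s2 ^ 2 * p i))
    by (intros; ring).
  rewrite !rsum_add, !rsum_scale, Hsum. unfold s2, s_k. ring.
Qed.

Lemma s3_sq_le_s2_cube n p : (forall i, (i < n)%nat -> 0 <= p i) ->
  s_k n p 3 ^ 2 <= s_k n p 2 ^ 3.
Proof.
  intros Hp. unfold s_k.
  pose proof (cauchy_schwarz n p (fun i => p i ^ 2)) as Hcs.
  pose proof (rsum_sq_le_sq_rsum n (fun i => p i ^ 2) (fun i _ => pow2_ge_0 (p i))) as Hs4.
  pose proof (rsum_nonneg n (fun i => p i ^ 2) (fun i _ => pow2_ge_0 (p i))) as Hs2.
  rewrite (rsum_ext n (fun q => p q ^ 3) (fun i => p i * p i ^ 2)) by (intros; ring).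
  cbv beta in *.
  apply (Rle_trans _ _ _ Hcs).
  replace (rsum n (fun q => p q ^ 2) ^ 3) with
    (rsum n (fun i => p i ^ 2) * rsum n (fun q => p q ^ 2) ^ 2) by ring.
  apply Rmult_le_compat_l; assumption.
Qed.

Lemma uniform_power_sum n p k : uniform n p -> s_k n p k = INR n * (1 / INR n) ^ k.
Proof.
  intros Hu. unfold s_k. rewrite <- rsum_const.
  apply rsum_ext. intros i Hi. rewrite Hu by exact Hi. reflexivity.
Qed.

Lemma uniform_iff_s3_eq_s2_sq n p : (0 < n)%nat ->
  (forall i, (i < n)%nat -> 0 < p i) -> rsum n p = 1 ->
  uniform n p <-> s_k n p 3 = s_k n p 2 ^ 2.
Proof.
  intros Hn Hp Hsum. assert (Hn0 : INR n <> 0) by (apply not_0_INR; lia).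
  split.
  - intros Hu. rewrite !(uniform_power_sum n p) by exact Hu. field. exact Hn0.
  - intros Hs. pose proof (variance_identity n p Hsum) as Hvar.
    rewrite Hs, Rminus_diag in Hvar. set (s2 := s_k n p 2) in Hvar.
    assert (Hterm : forall i, (i < n)%nat -> 0 <= p i * (p i - s2) ^ 2).
    { intros i Hi. pose proof (Hp i Hi). pose proof (pow2_ge_0 (p i - s2)). nra. }
    assert (Hconst : forall i, (i < n)%nat -> p i = s2).
    { intros i Hi.
      pose proof (rsum_nonneg_eq0 n _ i Hterm Hvar Hi) as Hi0. cbv beta in Hi0.
      pose proof (Hp i Hi). apply Rmult_integral in Hi0 as [Hi0 | Hi0]; [lra | nra]. }
    assert (Hs2 : INR n * s2 = 1) by (rewrite <- rsum_const, <- Hsum; apply rsum_ext;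
                                         intros; symmetry; apply Hconst; assumption).
    intros i Hi. rewrite Hconst by exact Hi. field_simplify_eq; [lra | exact Hn0].
Qed.

Lemma s2_bounds n p : (0 < n)%nat ->
  (forall i, (i < n)%nat -> 0 < p i < 1) -> rsum n p = 1 ->
  0 < s_k n p 2 < 1.
Proof.
  intros Hn Hp Hsum. unfold s_k. split.
  - replace 0 with (rsum n (fun _ => 0)) by (rewrite rsum_const; ring).
    apply rsum_lt; [exact Hn|]. intros i Hi. pose proof (Hp i Hi). nra.
  - rewrite <- Hsum. apply rsum_lt; [exact Hn|]. intros i Hi. pose proof (Hp i Hi). nra.
Qed.

Lemma cubic_denominator_pos s2 s3 :
  0 < s2 < 1 -> 0 <= s3 -> s3 ^ 2 <= s2 ^ 3 -> 0 < 2 * s2 ^ 3 - 3 * s3 * s2 + s3.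
Proof.
  intros [Hs2 Hs2'] Hs3 Hcs.
  assert (Hcube : 0 < s2 ^ 3) by (apply pow_lt; exact Hs2).
  destruct (Rle_lt_dec s2 (1 / 3)) as [Hsmall | Hlarge]; [nra|].
  (* Otherwise 2 s2^3 <= s3 (3 s2 - 1) would square to 4 s2^3 <= (3 s2 - 1)^2,
     i.e. (s2 - 1)^2 (4 s2 - 1) <= 0. *)
  apply Rnot_le_lt. intros Hneg.
  assert (Hsq : (2 * s2 ^ 3) ^ 2 <= s2 ^ 3 * (3 * s2 - 1) ^ 2).
  { apply Rle_trans with ((s3 * (3 * s2 - 1)) ^ 2).
    - apply pow_incr. lra.
    - rewrite Rpow_mult_distr. apply Rmult_le_compat_r; [apply pow2_ge_0 | exact Hcs]. }
  assert (Hcubic : 4 * s2 ^ 3 <= (3 * s2 - 1) ^ 2) by nra.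
  assert (0 < (s2 - 1) ^ 2 * (4 * s2 - 1)) by (apply Rmult_lt_0_compat; nra).
  nra.
Qed.

Lemma aff_sym a b q l : aff a b q l = aff a b l q.
Proof. unfold aff. rewrite Nat.eqb_sym. reflexivity. Qed.

Lemma aff_mul a b c d q l : aff a b q l * aff c d q l = aff (a * c) (b * d) q l.
Proof. unfold aff. destruct (Nat.eqb q l); reflexivity. Qed.

Lemma rsum_aff_outside n q g a b : (n <= q)%nat ->
  rsum n (fun l => g l * aff a b q l) = b * rsum n g.
Proof.
  intros Hq. rewrite <- rsum_scale. apply rsum_ext. intros l Hl.
  unfold aff. rewrite (proj2 (Nat.eqb_neq q l)) by lia. ring.
Qed.

Lemma rsum_aff n q g a b : (q < n)%nat ->
  rsum n (fun l => g l * aff a b q l) = b * rsum n g + (a - b) * g q.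
Proof.
  induction n as [|n IH]; intros Hq; [lia|]. cbn [rsum].
  destruct (Nat.eq_dec q n) as [->|Hqn].
  - rewrite rsum_aff_outside by lia. unfold aff. rewrite Nat.eqb_refl. ring.
  - rewrite IH by lia. unfold aff. rewrite (proj2 (Nat.eqb_neq q n) Hqn). ring.
Qed.

Lemma rsum_prob_aff n p a b q : rsum n p = 1 -> (q < n)%nat ->
  rsum n (fun l => p l * aff a b q l) = b + (a - b) * p q.
Proof. intros Hsum Hq. rewrite rsum_aff, Hsum by exact Hq. ring. Qed.

Section Moments.

Variables (Q : nat) (pi : nat -> R) (alpha beta : R).
Hypothesis pi_sum1 : rsum Q pi = 1.

Let delta := alpha - beta.
Let s2 := s_k Q pi 2.
Let s3 := s_k Q pi 3.

Lemma m1_power_sums : m1 Q pi alpha beta = beta + delta * s2.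
Proof.
  unfold m1.
  rewrite (rsum_ext Q _ (fun q => beta * pi q + delta * pi q ^ 2)).
  - rewrite rsum_add, !rsum_scale, pi_sum1. unfold s2, s_k. ring.
  - intros q Hq.
    rewrite (rsum_ext Q _ (fun l => pi q * (pi l * aff alpha beta q l))) by (intros; ring).
    rewrite rsum_scale, rsum_prob_aff by assumption. unfold delta. ring.
Qed.

Lemma m2_power_sums :
  m2 Q pi alpha beta = beta ^ 2 + 2 * beta * delta * s2 + delta ^ 2 * s3.
Proof.
  unfold m2.
  rewrite (rsum_ext Q _ (fun q => beta ^ 2 * pi q + (2 * beta * delta) * pi q ^ 2
                                  + delta ^ 2 * pi q ^ 3)).
  - rewrite !rsum_add, !rsum_scale, pi_sum1. unfold s2, s3, s_k. ring.
  - intros q Hq.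
    rewrite (rsum_ext Q _ (fun l => pi q * (beta + delta * pi q) * (pi l * aff alpha beta q l))).
    + rewrite rsum_scale, rsum_prob_aff by assumption. unfold delta. ring.
    + intros l Hl.
      rewrite (rsum_ext Q _ (fun r => pi q * pi l * aff alpha beta q l
                                      * (pi r * aff alpha beta q r))) by (intros; ring).
      rewrite rsum_scale, rsum_prob_aff by assumption. unfold delta. ring.
Qed.

Lemma m3_power_sums :
  m3 Q pi alpha beta =
  beta ^ 3 + 3 * beta ^ 2 * delta * s2 + 3 * beta * delta ^ 2 * s3 + delta ^ 3 * s3.
Proof.
  unfold m3.
  rewrite (rsum_ext Q _ (fun q => (beta ^ 3 + delta * beta ^ 2 * s2) * pi q
      + (2 * beta ^ 2 * delta) * pi q ^ 2
      + (beta * delta ^ 2 + delta * (alpha ^ 2 - beta ^ 2)) * pi q ^ 3)).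
  - rewrite !rsum_add, !rsum_scale, pi_sum1. unfold s2, s3, s_k, delta. ring.
  - intros q Hq.
    rewrite (rsum_ext Q _ (fun l => beta ^ 2 * pi q * (pi l * aff alpha beta q l)
        + beta * delta * pi q * (pi l ^ 2 * aff alpha beta q l)
        + delta * pi q ^ 2 * (pi l * aff (alpha * alpha) (beta * beta) q l))).
    + rewrite !rsum_add, !rsum_scale, (rsum_aff Q q (fun l => pi l ^ 2)),
        rsum_prob_aff, rsum_prob_aff by assumption.
      unfold s2, s_k, delta. ring.
    + intros l Hl.
      rewrite (rsum_ext Q _ (fun r => pi q * pi l * aff alpha beta q l
                                      * (pi r * aff alpha beta l r * aff alpha beta q r)))
        by (intros; ring).
      rewrite rsum_scale, rsum_aff, rsum_prob_aff by assumption.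
      rewrite (aff_sym _ _ l q), <- aff_mul. unfold delta. ring.
Qed.

End Moments.

Lemma Rpower_cube_third x : 0 < x -> Rpower (x ^ 3) (1 / 3) = x.
Proof.
  intros Hx. rewrite <- Rpower_pow, Rpower_mult by exact Hx.
  replace (INR 3 * (1 / 3)) with 1 by (simpl; field). apply Rpower_1. exact Hx.
Qed.

Lemma cbrt_cube x : cbrt (x ^ 3) = x.
Proof.
  unfold cbrt. destruct (Rtotal_order x 0) as [Hneg | [-> | Hpos]].
  - assert (Hc : 0 < (- x) ^ 3) by (apply pow_lt; lra).
    replace ((- x) ^ 3) with (- x ^ 3) in Hc by ring.
    destruct (Rlt_dec 0 (x ^ 3)); [lra|]. destruct (Rlt_dec (x ^ 3) 0); [|lra].
    replace (- x ^ 3) with ((- x) ^ 3) by ring. rewrite Rpower_cube_third; lra.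
  - replace (0 ^ 3) with 0 by ring.
    destruct (Rlt_dec 0 0); [lra|]. destruct (Rlt_dec 0 0); [lra|]. reflexivity.
  - pose proof (pow_lt x 3 Hpos).
    destruct (Rlt_dec 0 (x ^ 3)); [|lra]. apply Rpower_cube_third. exact Hpos.
Qed.

Theorem theorem4 (Q : nat) (pi : nat -> R) (alpha beta : R) :
  (2 <= Q)%nat ->
  (forall q, (q < Q)%nat -> 0 < pi q < 1) ->
  rsum Q pi = 1 ->
  0 <= alpha <= 1 -> 0 <= beta <= 1 ->
  alpha <> beta ->
  let s2 := s_k Q pi 2 in
  let s3 := s_k Q pi 3 in
  let M1 := m1 Q pi alpha beta in
  let M2 := m2 Q pi alpha beta in
  let M3 := m3 Q pi alpha beta in
  (M2 <> M1 ^ 2 ->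
     ~ uniform Q pi /\
     M1 ^ 2 - M2 <> 0 /\
     2 * s2 ^ 3 - 3 * s3 * s2 + s3 <> 0 /\
     beta = ((s3 - s2 * s3) * M1 ^ 3 + (s2 ^ 3 - s3) * M2 * M1
             + (s3 * s2 - s2 ^ 3) * M3)
            / ((M1 ^ 2 - M2) * (2 * s2 ^ 3 - 3 * s3 * s2 + s3)) /\
     alpha = (M1 + (s2 - 1) * beta) / s2) /\
  (M2 = M1 ^ 2 ->
     uniform Q pi /\
     beta = M1 + cbrt ((M1 ^ 3 - M3) / (INR Q - 1)) /\
     alpha = INR Q * M1 + (1 - INR Q) * beta).
Proof.
  intros HQ Hpi Hsum _ _ Hab s2 s3 M1 M2 M3.
  assert (Hpos : forall q, (q < Q)%nat -> 0 < pi q) by (intros q Hq; apply Hpi, Hq).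
  pose proof (s2_bounds Q pi ltac:(lia) Hpi Hsum) as Hs2. fold s2 in Hs2.
  assert (Hs3 : 0 <= s3) by (apply rsum_nonneg; intros q Hq; apply pow_le, Rlt_le, Hpos, Hq).
  pose proof (cubic_denominator_pos s2 s3 Hs2 Hs3 (s3_sq_le_s2_cube Q pi
    (fun q Hq => Rlt_le _ _ (Hpos q Hq)))) as Hden.
  pose proof (uniform_iff_s3_eq_s2_sq Q pi ltac:(lia) Hpos Hsum) as Huniform.
  fold s2 s3 in Huniform.
  assert (Hd : (alpha - beta) ^ 2 <> 0) by (apply pow_nonzero; lra).
  unfold M1, M2, M3. rewrite m1_power_sums, m2_power_sums, m3_power_sums by exact Hsum.
  fold s2 s3.
  split.
  - intros Hne. assert (Hs : s3 - s2 ^ 2 <> 0) by (intros E; apply Hne; nra).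
    split; [|split; [|split; [|split]]].
    + rewrite Huniform. lra.
    + nra.
    + lra.
    + field. split; [lra | nra].
    + field. lra.
  - intros Heq.
    assert (Hs : s3 = s2 ^ 2) by (apply Rmult_eq_reg_l with ((alpha - beta) ^ 2); [nra|exact Hd]).
    assert (HQ1 : 1 < INR Q) by (apply lt_1_INR; lia).
    apply Huniform in Hs as Hu. split; [exact Hu|].
    assert (E2 : s2 = 1 / INR Q) by (unfold s2; rewrite uniform_power_sum by exact Hu; field; lra).
    assert (E3 : s3 = 1 / INR Q ^ 2) by (rewrite Hs, E2; field; lra).
    rewrite E2, E3.
    replace (((beta + (alpha - beta) * (1 / INR Q)) ^ 3 - _) / (INR Q - 1))
      with ((- (alpha - beta) / INR Q) ^ 3) by (field; lra).
    rewrite cbrt_cube. split; field; lra.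
Qed.
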